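(* Let $T$ be a truss with universal ring $(\mathrm{R}(T),\iota_T)$. The category of pointed $T$-modules is isomorphic to the usual, ring-theoretic, category of (left, not necessarily unital) $\mathrm{R}(T)$-modules. In particular, the category of pointed $T$-modules is an abelian category. Furthermore, if $T$ is unital, then this isomorphism restricts to an isomorphism between the category of unital pointed $T$-modules and the category of unital $\mathrm{R}(T)$-modules.
   Context: An abelian heap is a (possibly empty) set $H$ with a ternary operation $[-,-,-]$ satisfying $[a,b,[c,d,e]]=[[a,b,c],d,e]$, $[a,b,b]=a=[b,b,a]$ and $[a,b,c]=[c,b,a]$; heap morphisms preserve the bracket. A truss is an abelian heap $T$ with an associative binary multiplication such that $t[s,s',s'']=[ts,ts',ts'']$ and $[s,s',s'']t=[st,s't,s''t]$; it is unital if it has a two-sided multiplicative identity $1_T$. Truss morphisms are multiplicative heap morphisms. Rings are not assumed unital. Every ring $R$ yields a truss $\mathrm{T}(R)$ with the same multiplication and bracket $[a,b,c]=a-b+c$. The universal ring $\mathrm{R}(T)$ of a truss $T$ is a ring with a truss morphism $\iota_T\colon T\to \mathrm{T}(\mathrm{R}(T))$ such that every truss morphism $\varphi\colon T\to \mathrm{T}(R)$, $R$ a ring, factors as $\varphi=\hat\varphi\circ\iota_T$ for a unique ring homomorphism $\hat\varphi\colon \mathrm{R}(T)\to R$. It exists for every $T$ (and is $0$ for $T=\varnothing$). For $T\neq\varnothing$ and $o\in T$, write $\mathrm{G}(T;o)$ for the abelian group on $T$ with addition $s+t=[s,o,t]$; then $\mathrm{R}(T)$ can be realised as $\mathrm{G}(T;o)\oplus\mathbb{Z}$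 with $(t,m)(s,n)=(ts+(n-1)to+(m-1)os+(m-1)(n-1)o^2,\,mn)$ and $\iota_T(t)=(t,1)$. $T$ is unital iff $\mathrm{R}(T)$ is unital, with unit $(1_T,1)$; in the unital case, if $R$ and $\varphi$ are unital then so is $\hat\varphi$. A pointed $T$-module is an abelian group $G$ with a map $\cdot\colon T\times G\to G$ such that $t\cdot(t'\cdot g)=(tt')\cdot g$, $[t,t',t'']\cdot g=t\cdot g-t'\cdot g+t''\cdot g$ and $t\cdot(g+h)=t\cdot g+t\cdot h$ for all $t,t',t''\in T$, $g,h\in G$. Morphisms are group homomorphisms $f$ with $f(t\cdot g)=t\cdot f(g)$. If $T$ is unital, $G$ is unital when $1_T\cdot g=g$ for all $g\in G$. *)

(* Defs.v *)
From HB Require Import structures.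
From mathcomp Require Import all_boot all_algebra.
From mathcomp Require Import boolp.

Set Implicit Arguments.
Unset Strict Implicit.
Unset Printing Implicit Defensive.

Import GRing.Theory.
Local Open Scope ring_scope.

Record abelian_heap := AbelianHeap {
  heap_sort :> Type;
  brk : heap_sort -> heap_sort -> heap_sort -> heap_sort;
  brkA : forall a b c d e, brk a b (brk c d e) = brk (brk a b c) d e;
  brkKr : forall a b, brk a b b = a;
  brkKl : forall a b, brk b b a = a;
  brkC : forall a b c, brk a b c = brk c b a
}.

Record truss := Truss {
  truss_heap :> abelian_heap;
  tmul : truss_heap -> truss_heap -> truss_heap;
  tmulA : associative tmul;
  tmul_brkr : forall t a b c,
    tmul t (brk a b c) = brk (tmul t a) (tmul t b) (tmul t c);
  tmul_brkl : forall t a b c,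
    tmul (brk a b c) t = brk (tmul a t) (tmul b t) (tmul c t)
}.

Record truss_hom (S T : truss) := TrussHom {
  truss_fun :> S -> T;
  truss_fun_brk : forall a b c,
    truss_fun (brk a b c) = brk (truss_fun a) (truss_fun b) (truss_fun c);
  truss_funM : forall a b,
    truss_fun (tmul a b) = tmul (truss_fun a) (truss_fun b)
}.

(* Associative rings, not assumed unital: the library's rings all have a 1. *)
Record rng := Rng {
  rng_sort :> zmodType;
  rmul : rng_sort -> rng_sort -> rng_sort;
  rmulA : associative rmul;
  rmulDl : left_distributive rmul +%R;
  rmulDr : right_distributive rmul +%R
}.

Record rng_hom (R S : rng) := RngHom {
  rng_fun :> {additive R -> S};
  rng_funM : forall a b, rng_fun (rmul a b) = rmul (rng_fun a) (rng_fun b)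
}.

Definition is_unit (A : Type) (mul : A -> A -> A) (e : A) : Prop :=
  left_id e mul /\ right_id e mul.

Section TrussOfRng.
Variable R : rng.

Let rbrk (a b c : R) : R := a - b + c.

Fact rbrkA a b c d e : rbrk a b (rbrk c d e) = rbrk (rbrk a b c) d e.
Proof. by rewrite /rbrk !addrA. Qed.

Fact rbrkKr a b : rbrk a b b = a.
Proof. by rewrite /rbrk subrK. Qed.

Fact rbrkKl a b : rbrk b b a = a.
Proof. by rewrite /rbrk subrr add0r. Qed.

Fact rbrkC a b c : rbrk a b c = rbrk c b a.
Proof. by rewrite /rbrk addrAC (addrC a) addrAC. Qed.

Definition heap_of_rng : abelian_heap := AbelianHeap rbrkA rbrkKr rbrkKl rbrkC.

Let rmulBr (t a b : R) : rmul t (a - b) = rmul t a - rmul t b.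
Proof. by apply: (addIr (rmul t b)); rewrite -rmulDr !subrK. Qed.

Let rmulBl (t a b : R) : rmul (a - b) t = rmul a t - rmul b t.
Proof. by apply: (addIr (rmul b t)); rewrite -rmulDl !subrK. Qed.

Fact rmul_brkr (t a b c : heap_of_rng) :
  rmul t (brk a b c) = brk (rmul t a : heap_of_rng) (rmul t b) (rmul t c).
Proof. by rewrite /= /rbrk rmulDr rmulBr. Qed.

Fact rmul_brkl (t a b c : heap_of_rng) :
  rmul (brk a b c) t = brk (rmul a t : heap_of_rng) (rmul b t) (rmul c t).
Proof. by rewrite /= /rbrk rmulDl rmulBl. Qed.

Definition truss_of_rng : truss :=
  @Truss heap_of_rng (@rmul R) (@rmulA R) rmul_brkr rmul_brkl.

End TrussOfRng.

Definition is_universal_ring (T : truss) (R : rng)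
    (iota : truss_hom T (truss_of_rng R)) : Prop :=
  forall (S : rng) (phi : truss_hom T (truss_of_rng S)),
    exists! f : rng_hom R S, forall t : T, phi t = f (iota t).

Record category := Category {
  obj :> Type;
  hom : obj -> obj -> Type;
  idc : forall a, hom a a;
  compc : forall a b c, hom b c -> hom a b -> hom a c;
  comp1f : forall a b (f : hom a b), compc (idc b) f = f;
  compf1 : forall a b (f : hom a b), compc f (idc a) = f;
  compA : forall a b c d (h : hom c d) (g : hom b c) (f : hom a b),
    compc h (compc g f) = compc (compc h g) f
}.
Arguments idc {_} _.

Declare Scope category_scope.
Delimit Scope category_scope with cat.
Local Open Scope category_scope.
Notation "g \c f" := (compc g f) (at level 50, left associativity)
  : category_scope.

Record functor (C D : category) := Functor {
  fobj :> C -> D;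
  fmap : forall a b : C, hom a b -> hom (fobj a) (fobj b);
  fmap1 : forall a : C, fmap (idc a) = idc (fobj a);
  fmap_comp : forall (a b c : C) (g : hom b c) (f : hom a b),
    fmap (g \c f) = fmap g \c fmap f
}.

Definition functor_id (C : category) : functor C C :=
  @Functor C C (fun a => a) (fun a b f => f)
    (fun a => erefl) (fun a b c g f => erefl).

Section FunctorComp.
Variables (C D E : category) (G : functor D E) (F : functor C D).

Fact functor_comp1 (a : C) : fmap G (fmap F (idc a)) = idc (G (F a)).
Proof. by rewrite !fmap1. Qed.

Fact functor_compM (a b c : C) (g : hom b c) (f : hom a b) :
  fmap G (fmap F (g \c f)) = fmap G (fmap F g) \c fmap G (fmap F f).
Proof. by rewrite !fmap_comp. Qed.

Definition functor_comp : functor C E :=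
  @Functor C E (fun a => G (F a)) (fun a b f => fmap G (fmap F f))
    functor_comp1 functor_compM.

End FunctorComp.

Definition is_isomorphism (C D : category) (F : functor C D) : Prop :=
  exists G : functor D C,
    functor_comp G F = functor_id C /\ functor_comp F G = functor_id D.

Definition induced_category (C : category) (A : Type) (o : A -> C) : category :=
  @Category A (fun a b => hom (o a) (o b)) (fun a => idc (o a))
    (fun a b c g f => g \c f)
    (fun a b f => comp1f f) (fun a b f => compf1 f)
    (fun a b c d h g f => compA h g f).

Definition full_subcategory (C : category) (P : C -> Prop) : category :=
  @induced_category C {a : C | P a} sval.

Definition functor_restr (C D : category) (P : C -> Prop) (Q : D -> Prop)
    (F : functor C D) (PQ : forall a, P a -> Q (F a)) :
    functor (full_subcategory P) (full_subcategory Q) :=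
  @Functor (full_subcategory P) (full_subcategory Q)
    (fun a => exist Q (F (sval a)) (PQ _ (svalP a)))
    (fun a b f => @fmap C D F (sval a) (sval b) f)
    (fun a => fmap1 F (sval a))
    (fun a b c g f => @fmap_comp C D F (sval a) (sval b) (sval c) g f).

Record preadditive (C : category) := Preadditive {
  hadd : forall a b : C, hom a b -> hom a b -> hom a b;
  hzero : forall a b : C, hom a b;
  hopp : forall a b : C, hom a b -> hom a b;
  haddA : forall a b : C, associative (@hadd a b);
  haddC : forall a b : C, commutative (@hadd a b);
  hadd0f : forall a b : C, left_id (hzero a b) (@hadd a b);
  haddNf : forall a b : C, left_inverse (hzero a b) (@hopp a b) (@hadd a b);
  compDl : forall (a b c : C) (g h : hom b c) (f : hom a b),
    hadd g h \c f = hadd (g \c f) (h \c f);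
  compDr : forall (a b c : C) (h : hom b c) (f g : hom a b),
    h \c hadd f g = hadd (h \c f) (h \c g)
}.
Arguments hzero {_} _ _ _.

Section Abelian.
Variables (C : category) (A : preadditive C).

Definition mono (a b : C) (f : hom a b) : Prop :=
  forall (c : C) (g h : hom c a), f \c g = f \c h -> g = h.

Definition epi (a b : C) (f : hom a b) : Prop :=
  forall (c : C) (g h : hom b c), g \c f = h \c f -> g = h.

Definition is_zero_object (z : C) : Prop :=
  forall a : C, (exists! f : hom a z, True) /\ (exists! f : hom z a, True).

Definition is_biproduct (a b s : C) (i1 : hom a s) (i2 : hom b s)
    (p1 : hom s a) (p2 : hom s b) : Prop :=
  [/\ p1 \c i1 = idc a, p2 \c i2 = idc b
    & hadd A (i1 \c p1) (i2 \c p2) = idc s].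

Definition is_kernel (a b k : C) (f : hom a b) (i : hom k a) : Prop :=
  f \c i = hzero A k b /\
  forall (c : C) (g : hom c a), f \c g = hzero A c b ->
    exists! u : hom c k, i \c u = g.

Definition is_cokernel (a b q : C) (f : hom a b) (p : hom b q) : Prop :=
  p \c f = hzero A a q /\
  forall (c : C) (g : hom b c), g \c f = hzero A a c ->
    exists! u : hom q c, u \c p = g.

End Abelian.

Definition is_abelian (C : category) : Prop :=
  exists A : preadditive C,
    (exists z : C, is_zero_object z) /\
    (forall a b : C, exists (s : C) (i1 : hom a s) (i2 : hom b s)
       (p1 : hom s a) (p2 : hom s b), is_biproduct A i1 i2 p1 p2) /\
    (forall (a b : C) (f : hom a b),
       exists (k : C) (i : hom k a), is_kernel A f i) /\
    (forall (a b : C) (f : hom a b),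
       exists (q : C) (p : hom b q), is_cokernel A f p) /\
    (forall (a b : C) (i : hom a b), mono i ->
       exists (c : C) (f : hom b c), is_kernel A f i) /\
    (forall (a b : C) (p : hom a b), epi p ->
       exists (c : C) (f : hom c a), is_cokernel A f p).

(* An abelian group with a family of self-maps indexed by X; both kinds of
   modules below have these as underlying data, and as morphisms the
   equivariant homomorphisms.  A zmodType also carries a choice operator, which
   is never used here and exists classically on any abelian group. *)
Record opgroup (X : Type) := OpGroup {
  op_group :> zmodType;
  act : X -> op_group -> op_group
}.

Record op_hom (X : Type) (G H : opgroup X) := OpHom {
  op_fun :> {additive G -> H};
  op_fun_act : forall (x : X) (g : G), op_fun (act x g) = act x (op_fun g)
}.

Section OpGroupCategory.
Variable X : Type.

Lemma op_hom_ext (G H : opgroup X) (f g : op_hom G H) : f =1 g -> f = g.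
Proof.
case: f => [[f [[cf]]] ef]; case: g => [[g [[cg]]] eg] /= fg.
move: cf ef cg eg; rewrite (funext fg : f = g) => cf ef cg eg.
rewrite (Prop_irrelevance cf cg) in ef *.
by rewrite (Prop_irrelevance ef eg).
Qed.

Definition op_id (G : opgroup X) : op_hom G G :=
  @OpHom X G G (idfun : {additive G -> G}) (fun x g => erefl).

Fact op_comp_act (G H K : opgroup X) (h : op_hom H K) (f : op_hom G H) x g :
  (h \o f) (act x g) = act x ((h \o f) g).
Proof. by rewrite /= !op_fun_act. Qed.

Definition op_comp (G H K : opgroup X) (h : op_hom H K) (f : op_hom G H) :
    op_hom G K :=
  @OpHom X G K (h \o f : {additive G -> K}) (op_comp_act h f).

Fact op_comp1f (G H : opgroup X) (f : op_hom G H) : op_comp (op_id H) f = f.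
Proof. exact: op_hom_ext. Qed.

Fact op_compf1 (G H : opgroup X) (f : op_hom G H) : op_comp f (op_id G) = f.
Proof. exact: op_hom_ext. Qed.

Fact op_compA (G H K L : opgroup X)
    (h : op_hom K L) (g : op_hom H K) (f : op_hom G H) :
  op_comp h (op_comp g f) = op_comp (op_comp h g) f.
Proof. exact: op_hom_ext. Qed.

Definition opgroup_cat : category :=
  Category op_comp1f op_compf1 op_compA.

End OpGroupCategory.

Record pointed_module (T : truss) := PointedModule {
  pmod_opgroup :> opgroup T;
  pmod_actM : forall (t t' : T) (g : pmod_opgroup),
    act t (act t' g) = act (tmul t t') g;
  pmod_act_brk : forall (t t' t'' : T) (g : pmod_opgroup),
    act (brk t t' t'') g = act t g - act t' g + act t'' g;
  pmod_actD : forall (t : T) (g h : pmod_opgroup),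
    act t (g + h) = act t g + act t h
}.

Record rng_module (R : rng) := RngModule {
  rmod_opgroup :> opgroup R;
  rmod_actM : forall (r s : R) (m : rmod_opgroup),
    act r (act s m) = act (rmul r s) m;
  rmod_actDl : forall (r s : R) (m : rmod_opgroup),
    act (r + s) m = act r m + act s m;
  rmod_actDr : forall (r : R) (m n : rmod_opgroup),
    act r (m + n) = act r m + act r n
}.

Definition pointed_module_cat (T : truss) : category :=
  @induced_category (opgroup_cat T) (pointed_module T) (@pmod_opgroup T).

Definition rng_module_cat (R : rng) : category :=
  @induced_category (opgroup_cat R) (rng_module R) (@rmod_opgroup R).

Definition unital_pointed_module (T : truss) (e : T)
    (G : pointed_module_cat T) : Prop :=
  forall g : (G : pointed_module T), act e g = g.

Definition unital_rng_module (R : rng) (u : R)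
    (M : rng_module_cat R) : Prop :=
  forall m : (M : rng_module R), act u m = m.

(* Main.v *)
(* A pointed T-module structure on an abelian group G is a truss morphism from
   T to T(End G), which by universality extends uniquely to a ring homomorphism
   R -> End G, i.e. to an R-module structure on the same group; restricting
   along iota is the inverse.  A subring of R containing iota(T) is all of R,
   since the universal map into it, followed by the inclusion, is the identity;
   hence T-equivariance of a homomorphism implies R-equivariance, and iota
   maps the unit of T to a unit of R.  Kernels, cokernels and biproducts of
   pointed T-modules are computed in abelian groups. *)
From HB Require Import structures.
From mathcomp Require Import all_boot all_algebra.
From mathcomp Require Import boolp.
Require Import Defs.

Set Implicit Arguments.
Unset Strict Implicit.
Unset Printing Implicit Defensive.

Import GRing.Theory.
Local Open Scope ring_scope.
Local Open Scope quotient_scope.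
Local Open Scope category_scope.

(** * Equality of functors and isomorphisms of categories *)

(** Proof irrelevance turns the equality of first components into [erefl], so no transport
    remains. *)
Lemma existT_inj (A : Type) (B : A -> Type) (x : A) (y z : B x) :
  existT B x y = existT B x z -> y = z.
Proof.
move=> e; have := projT2_eq e.
by rewrite (Prop_irrelevance (projT1_eq e) erefl).
Qed.

(* Packing a morphism with its endpoints allows equating morphisms whose
   endpoints are only propositionally equal. *)
Definition arrow (C : category) (a b : C) (f : hom a b) :
    {p : C * C & hom p.1 p.2} :=
  existT (fun p : C * C => hom p.1 p.2) (a, b) f.

Lemma arrow_dom (C : category) (a b a' b' : C) (f : hom a b) (f' : hom a' b') :
  arrow f = arrow f' -> a = a'.
Proof. by move=> e; have [] := projT1_eq e. Qed.

Section InducedIdentity.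
Variables (C : category) (A : Type) (o : A -> C).
Hypothesis o_inj : injective o.

(** Arrows of [C] can be compared before the object map is known. Domains of identity arrows and
    injectivity of [o] force the object map to be the identity; only then do the two morphism maps
    have the same type. *)
Lemma induced_functor_eq_id
    (F : functor (induced_category o) (induced_category o)) :
  (forall (a b : induced_category o) (f : hom a b),
     arrow (fmap F f : hom (o (F a)) (o (F b))) =
     arrow (f : hom (o a) (o b))) ->
  F = functor_id (induced_category o).
Proof.
case: F => F0 F1 e1 eM /= FE.
have F0E : F0 = id.
  by apply: funext => a; apply: o_inj; apply: arrow_dom (FE _ _ (idc a)).
move: F1 e1 eM FE; rewrite {}F0E => F1 e1 eM FE.
have F1E : F1 = fun a b f => f.
  apply: functional_extensionality_dep => a.
  apply: functional_extensionality_dep => b.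
  by apply: funext => f; apply: existT_inj (FE _ _ f).
move: e1 eM; rewrite {}F1E => e1 eM.
by rewrite /functor_id; congr Functor; apply: Prop_irrelevance.
Qed.

End InducedIdentity.

Section RestrictIsomorphism.
Variables (C D : category) (F : functor C D) (G : functor D C).
Hypotheses (GF : functor_comp G F = functor_id C)
           (FG : functor_comp F G = functor_id D).
Variables (P : C -> Prop) (Q : D -> Prop).
Hypotheses (PQ : forall a, P a -> Q (F a)) (QP : forall b, Q b -> P (G b)).

Lemma arrow_functor_id (E : category) (H : functor E E) (a b : E)
    (f : hom a b) :
  H = functor_id E -> arrow (fmap H f) = arrow f.
Proof. by move->. Qed.

Lemma sval_inj_prop (A : Type) (p : A -> Prop) : injective (@sval A p).
Proof.
by move=> [x px] [y py] /= e; subst y; rewrite (Prop_irrelevance px py).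
Qed.

(** The inverse restricts as well, and an object of a full subcategory is determined by its
    underlying object, so the composites are compared through their arrows in [C] and [D]. *)
Lemma restr_isomorphism : is_isomorphism (functor_restr PQ).
Proof.
exists (functor_restr QP); split.
  apply: induced_functor_eq_id => [|a b f]; first exact: sval_inj_prop.
  exact: arrow_functor_id (f : @hom C _ _) GF.
apply: induced_functor_eq_id => [|a b f]; first exact: sval_inj_prop.
exact: arrow_functor_id (f : @hom D _ _) FG.
Qed.

End RestrictIsomorphism.

(** * Subgroups and non-unital subrings as types *)

Section Subgroup.
Variables (V : zmodType) (S : zmodClosed V).

Record subgroup := Subgroup { subgroup_val : V; _ : subgroup_val \in S }.

HB.instance Definition _ := [isSub for subgroup_val].
HB.instance Definition _ := [Choice of subgroup by <:].
HB.instance Definition _ := [SubChoice_isSubZmodule of subgroup by <:].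

End Subgroup.

Section PropSubgroup.
Variables (V : zmodType) (P : V -> Prop).
Hypotheses (P0 : P 0) (PB : forall x y, P x -> P y -> P (x - y)).

Fact prop_zmod_closed : zmod_closed (fun x => `[< P x >]).
Proof.
split=> [|x y]; first exact/asboolP.
by rewrite !unfold_in => /asboolP Px /asboolP Py; apply/asboolP/PB.
Qed.

(** Membership in a [zmodClosed] is boolean, so a propositional predicate enters through its
    classical truth value. *)
Definition prop_zmodClosed : zmodClosed V :=
  HB.pack (fun x => `[< P x >] : bool)
    (GRing.isZmodClosed.Build V _ prop_zmod_closed).

Lemma in_prop_zmodClosed x : (x \in prop_zmodClosed) = `[< P x >].
Proof. by []. Qed.

End PropSubgroup.

Section RngTheory.
Variable R : rng.

Lemma rmulBr (t a b : R) : rmul t (a - b) = rmul t a - rmul t b.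
Proof. by apply: (addIr (rmul t b)); rewrite -rmulDr !subrK. Qed.

Lemma rmulBl (t a b : R) : rmul (a - b) t = rmul a t - rmul b t.
Proof. by apply: (addIr (rmul b t)); rewrite -rmulDl !subrK. Qed.

Lemma rmulr0 (t : R) : rmul t 0 = 0.
Proof. by apply: (addIr (rmul t 0)); rewrite -rmulDr !add0r. Qed.

Lemma rmul0r (t : R) : rmul 0 t = 0.
Proof. by apply: (addIr (rmul 0 t)); rewrite -rmulDl !add0r. Qed.

Variable S : zmodClosed R.
Hypothesis SM : forall x y, x \in S -> y \in S -> rmul x y \in S.

Definition subrng_mul (x y : subgroup S) : subgroup S :=
  Subgroup (SM (valP x) (valP y)).

Fact subrng_mulA : associative subrng_mul.
Proof. by move=> x y z; apply: val_inj; apply: rmulA. Qed.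

Fact subrng_mulDl : left_distributive subrng_mul +%R.
Proof. by move=> x y z; apply: val_inj; exact: rmulDl. Qed.

Fact subrng_mulDr : right_distributive subrng_mul +%R.
Proof. by move=> x y z; apply: val_inj; exact: rmulDr. Qed.

Definition subrng : rng := Rng subrng_mulA subrng_mulDl subrng_mulDr.

End RngTheory.

(** * The endomorphism ring of an abelian group *)

Section Endomorphisms.
Variable G : zmodType.

Definition endo : Type := {additive G -> G}.
HB.instance Definition _ := gen_eqMixin endo.
HB.instance Definition _ := gen_choiceMixin endo.

Lemma additive_ext (f g : {additive G -> G}) : f =1 g -> f = g.
Proof.
case: f => [f [[f_mor]]]; case: g => [g [[g_mor]]] /= fg.
move: f_mor g_mor; rewrite (funext fg : f = g) => f_mor g_mor.
by rewrite (Prop_irrelevance f_mor g_mor).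
Qed.

Let endo_add (f g : endo) : endo := f \+ g : {additive G -> G}.
Let endo_zero : endo := \0 : {additive G -> G}.
Let endo_opp (f : endo) : endo := (\- f)%R : {additive G -> G}.

Fact endo_addA : associative endo_add.
Proof. by move=> f g h; apply: additive_ext => x; apply: addrA. Qed.
Fact endo_addC : commutative endo_add.
Proof. by move=> f g; apply: additive_ext => x; apply: addrC. Qed.
Fact endo_add0 : left_id endo_zero endo_add.
Proof. by move=> f; apply: additive_ext => x; apply: add0r. Qed.
Fact endo_addN : left_inverse endo_zero endo_opp endo_add.
Proof. by move=> f; apply: additive_ext => x; apply: addNr. Qed.

HB.instance Definition _ :=
  GRing.isZmodule.Build endo endo_addA endo_addC endo_add0 endo_addN.

Definition endo_comp (f g : endo) : endo := f \o g : {additive G -> G}.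

Fact endo_compA : associative endo_comp.
Proof. by move=> f g h; apply: additive_ext. Qed.
Fact endo_compDl : left_distributive endo_comp +%R.
Proof. by move=> f g h; apply: additive_ext. Qed.
Fact endo_compDr : right_distributive endo_comp +%R.
Proof. by move=> f g h; apply: additive_ext => x; apply: raddfD. Qed.

Definition endo_rng : rng := Rng endo_compA endo_compDl endo_compDr.

End Endomorphisms.

(** * Consequences of universality: separation, generation and units *)

Section UniversalRing.
Variables (T : truss) (R : rng) (iota : truss_hom T (truss_of_rng R)).
Hypothesis univ : is_universal_ring iota.

(** Both maps factor the truss morphism [phi] obtained by composing [f] with [iota], and such a
    factorisation is unique. *)
Lemma universal_hom_eq (S : rng) (f g : rng_hom R S) :
  (forall t, f (iota t) = g (iota t)) -> f =1 g.
Proof.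
move=> fg r.
pose phi t : truss_of_rng S := f (iota t).
have phi_brk a b c : phi (brk a b c) = brk (phi a) (phi b) (phi c).
  by rewrite /phi truss_fun_brk /= raddfD raddfB.
have phiM a b : phi (tmul a b) = tmul (phi a) (phi b).
  by rewrite /phi truss_funM /= rng_funM.
have [h [_ h_uniq]] := univ (TrussHom phi_brk phiM).
by rewrite -(h_uniq f) // -(h_uniq g).
Qed.

(** An induction principle expressing that [R] is generated by the image of [iota]. *)
Lemma universal_ind (P : R -> Prop) :
    P 0 -> (forall x y, P x -> P y -> P (x - y)) ->
    (forall x y, P x -> P y -> P (rmul x y)) ->
    (forall t, P (iota t)) ->
  forall r, P r.
Proof.
move=> P0 PB PM Pi r.
pose S := prop_zmodClosed P0 PB.
have SM x y : x \in S -> y \in S -> rmul x y \in S.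
  by rewrite !in_prop_zmodClosed => /asboolP ? /asboolP ?; apply/asboolP; auto.
have Si t : iota t \in S by rewrite in_prop_zmodClosed; apply/asboolP.
pose phi t : truss_of_rng (subrng SM) := Subgroup (Si t).
have phi_brk a b c : phi (brk a b c) = brk (phi a) (phi b) (phi c).
  by apply: val_inj; rewrite /= truss_fun_brk.
have phiM a b : phi (tmul a b) = tmul (phi a) (phi b).
  by apply: val_inj; rewrite /= truss_funM.
have [h [h_iota _]] := univ (TrussHom phi_brk phiM).
have inclM x y : (val \o h : {additive R -> R}) (rmul x y) =
    rmul (val (h x)) (val (h y)) by rewrite /= rng_funM.
have id_M (x y : R) : (idfun : {additive R -> R}) (rmul x y) = rmul x y by [].
(* The inclusion composed with [h] and the identity agree on [iota], hence everywhere. *)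
have -> : r = val (h r).
  apply: esym; apply: (universal_hom_eq (f := RngHom inclM) (g := RngHom id_M)).
  by move=> t /=; rewrite -h_iota.
by have := valP (h r); rewrite in_prop_zmodClosed => /asboolP.
Qed.

(** The elements fixed by multiplication by [iota e] on a given side form a subring containing the
    image of [iota]. *)
Lemma universal_unit (e : T) :
  is_unit (@tmul T) e -> is_unit (@rmul R) (iota e).
Proof.
move=> [e1 e2]; split; apply: universal_ind.
- exact: rmulr0.
- by move=> x y ex ey; rewrite rmulBr ex ey.
- by move=> x y ex ey; rewrite rmulA ex.
- by move=> t; rewrite -[RHS]/(iota t) -[in RHS](e1 t) truss_funM.
- exact: rmul0r.
- by move=> x y ex ey; rewrite rmulBl ex ey.
- by move=> x y ex ey; rewrite -rmulA ey.
- by move=> t; rewrite -[RHS]/(iota t) -[in RHS](e2 t) truss_funM.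
Qed.

End UniversalRing.

(** * Construction and comparison of equivariant homomorphisms *)

Section OpHomConstruction.
Variables (X : Type) (G H : opgroup X) (f : G -> H).
Hypotheses (fB : {morph f : x y / x - y})
           (f_act : forall x g, f (act x g) = act x (f g)).

Definition op_hom_of : op_hom G H :=
  @OpHom X G H
    (HB.pack f (GRing.isZmodMorphism.Build G H f fB) : {additive G -> H}) f_act.

End OpHomConstruction.

(** The round trips between the two kinds of modules keep the group and the underlying map; this
    reduces their triviality to a pointwise comparison of actions. *)
Lemma arrow_opgroupE (X : Type) (G H : opgroup X) (a : X -> G -> G)
    (b : X -> H -> H) (f : @op_hom X (OpGroup a) (OpGroup b)) (g : op_hom G H) :
    (forall x y, a x y = act x y) -> (forall x y, b x y = act x y) -> f =1 g ->
  arrow (f : @hom (opgroup_cat X) _ _) = arrow (g : @hom (opgroup_cat X) _ _).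
Proof.
case: G H a b f g => [G aG] [H aH] /= a b f g aE bE fg.
have {}aE : a = aG by apply: funext => x; apply: funext => y; apply: aE.
have {}bE : b = aH by apply: funext => x; apply: funext => y; apply: bE.
subst a b; congr existT; exact: op_hom_ext.
Qed.

Lemma pmod_opgroup_inj (T : truss) : injective (@pmod_opgroup T).
Proof.
move=> [G p1 p2 p3] [H q1 q2 q3] /= GH; subst H.
by congr PointedModule; apply: Prop_irrelevance.
Qed.

Lemma rmod_opgroup_inj (R : rng) : injective (@rmod_opgroup R).
Proof.
move=> [G p1 p2 p3] [H q1 q2 q3] /= GH; subst H.
by congr RngModule; apply: Prop_irrelevance.
Qed.

Lemma pmod_actB (T : truss) (G : pointed_module T) (t : T) :
  {morph act t : x y / x - y :> G}.
Proof.
by move=> x y; apply: (addIr (act t y)); rewrite -pmod_actD !subrK.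
Qed.

(** * Extension and restriction of actions along [iota] *)

Section ModuleIsomorphism.
Variables (T : truss) (R : rng) (iota : truss_hom T (truss_of_rng R)).
Hypothesis univ : is_universal_ring iota.

Section Representation.
Variable G : pointed_module T.

Definition pmod_endo (t : T) : truss_of_rng (endo_rng G) :=
  HB.pack_for {additive G -> G} (act t)
    (GRing.isZmodMorphism.Build G G (act t) (@pmod_actB T G t)).

Fact pmod_endo_brk a b c :
  pmod_endo (brk a b c) = brk (pmod_endo a) (pmod_endo b) (pmod_endo c).
Proof. by apply: additive_ext => g; apply: pmod_act_brk. Qed.

Fact pmod_endoM a b : pmod_endo (tmul a b) = tmul (pmod_endo a) (pmod_endo b).
Proof. by apply: additive_ext => g; rewrite /= pmod_actM. Qed.

Definition pmod_rep : truss_hom T (truss_of_rng (endo_rng G)) :=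
  TrussHom pmod_endo_brk pmod_endoM.

(** Universality only asserts existence, so [cid] picks the factorisation; by uniqueness the pick is
    immaterial. *)
Definition universal_rep : rng_hom R (endo_rng G) :=
  projT1 (cid (univ pmod_rep)).

Lemma universal_rep_iota (t : T) (g : G) :
  (universal_rep (iota t) : {additive G -> G}) g = act t g.
Proof. by have [<- _] := projT2 (cid (univ pmod_rep)). Qed.

Definition extended_opgroup : opgroup R :=
  @OpGroup R G (fun r => universal_rep r : {additive G -> G}).

Fact extended_actM (r s : R) (g : extended_opgroup) :
  act r (act s g) = act (rmul r s) g.
Proof. by rewrite /= rng_funM. Qed.

Fact extended_actDl (r s : R) (g : extended_opgroup) :
  act (r + s) g = act r g + act s g.
Proof. by rewrite /= raddfD. Qed.

Fact extended_actDr (r : R) (g h : extended_opgroup) :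
  act r (g + h) = act r g + act r h.
Proof. exact: (raddfD (universal_rep r : {additive G -> G})). Qed.

Definition extended_module : rng_module R :=
  RngModule extended_actM extended_actDl extended_actDr.

End Representation.

Fact extend_act (G H : pointed_module T) (f : op_hom G H) (r : R)
    (g : extended_module G) :
  (f : G -> H) (act r g) = act r (f g : extended_module H).
Proof.
(* The element [g] stays quantified in the predicate: for a product, the hypothesis on [x] is used
   at [act y g]. *)
move: r g; apply: (universal_ind univ).
- by move=> g; rewrite /= !raddf0.
- by move=> x y fx fy g; move: (fx g) (fy g); rewrite /= !raddfB /= => <- <-.
- by move=> x y fx fy g; rewrite -!extended_actM fx fy.
- by move=> t g; rewrite /= !universal_rep_iota op_fun_act.
Qed.

(** Kept transparent, like its inverse below, so that the round trips visibly leave groups and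
    underlying maps unchanged. *)
Definition extend_functor :
  functor (pointed_module_cat T) (rng_module_cat R).
Proof.
refine (@Functor (pointed_module_cat T) (rng_module_cat R) extended_module
  (fun G H (f : op_hom G H) => @OpHom R (extended_module G) (extended_module H)
    f (extend_act f)) _ _).
- by move=> G; apply: op_hom_ext.
- by move=> G H K g f; apply: op_hom_ext.
Defined.

Section Restriction.
Variable M : rng_module R.

Definition restricted_opgroup : opgroup T :=
  @OpGroup T M (fun t m => act (iota t : R) m).

Fact restricted_actM (t t' : T) (m : restricted_opgroup) :
  act t (act t' m) = act (tmul t t') m.
Proof. by rewrite /= truss_funM rmod_actM. Qed.

Fact restricted_act_brk (t t' t'' : T) (m : restricted_opgroup) :
  act (brk t t' t'') m = act t m - act t' m + act t'' m.
Proof.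
rewrite /= truss_fun_brk /= rmod_actDl; congr (_ + _).
by apply: (addIr (act (iota t' : R) m)); rewrite -rmod_actDl !subrK.
Qed.

Fact restricted_actD (t : T) (m n : restricted_opgroup) :
  act t (m + n) = act t m + act t n.
Proof. exact: rmod_actDr. Qed.

Definition restricted_module : pointed_module T :=
  PointedModule restricted_actM restricted_act_brk restricted_actD.

Lemma rmod_actB (r : R) : {morph act r : x y / x - y :> M}.
Proof.
by move=> x y; apply: (addIr (act r y)); rewrite -rmod_actDr !subrK.
Qed.

Definition rmod_endo (r : R) : endo_rng M :=
  HB.pack_for {additive M -> M} (act r)
    (GRing.isZmodMorphism.Build M M (act r) (@rmod_actB r)).

Fact rmod_endoB : {morph rmod_endo : r s / r - s}.
Proof.
move=> r s; apply: additive_ext => m; apply: (addIr (act s m)).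
by rewrite /= -rmod_actDl !subrK.
Qed.

Fact rmod_endoM (r s : R) :
  rmod_endo (rmul r s) = rmul (rmod_endo r) (rmod_endo s).
Proof. by apply: additive_ext => m; rewrite /= rmod_actM. Qed.

Definition rmod_rep : rng_hom R (endo_rng M) :=
  @RngHom R (endo_rng M)
    (HB.pack_for {additive R -> endo_rng M} rmod_endo
      (GRing.isZmodMorphism.Build R (endo_rng M) rmod_endo rmod_endoB))
    rmod_endoM.

(** The given action is itself a ring homomorphism [rmod_rep] to the endomorphisms of [M], and it
    agrees on [iota] with the extension of its restriction. *)
Lemma universal_rep_restricted (r : R) (m : M) :
  (universal_rep restricted_module r : {additive M -> M}) m = act r m.
Proof.
rewrite (universal_hom_eq univ (g := rmod_rep)) // => t.
by apply: additive_ext => x; rewrite universal_rep_iota.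
Qed.

End Restriction.

Definition restrict_functor :
  functor (rng_module_cat R) (pointed_module_cat T).
Proof.
refine (@Functor (rng_module_cat R) (pointed_module_cat T) restricted_module
  (fun M N (f : op_hom M N) =>
    @OpHom T (restricted_module M) (restricted_module N)
    f (fun t m => op_fun_act f (iota t : R) m)) _ _).
- by move=> M; apply: op_hom_ext.
- by move=> M N K g f; apply: op_hom_ext.
Defined.

Lemma restrict_extend :
  functor_comp restrict_functor extend_functor =
  functor_id (pointed_module_cat T).
Proof.
apply: induced_functor_eq_id => [|G H f]; first exact: pmod_opgroup_inj.
by apply: arrow_opgroupE => // t g; apply: universal_rep_iota.
Qed.

Lemma extend_restrict :
  functor_comp extend_functor restrict_functor =
  functor_id (rng_module_cat R).
Proof.
apply: induced_functor_eq_id => [|M N f]; first exact: rmod_opgroup_inj.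
by apply: arrow_opgroupE => // r m; apply: universal_rep_restricted.
Qed.

Section Unital.
Variable e : T.

Lemma extend_unital (G : pointed_module_cat T) :
  unital_pointed_module e G ->
  unital_rng_module (iota e : R) (extend_functor G).
Proof. by move=> eG g; rewrite -[RHS](eG g); apply: universal_rep_iota. Qed.

Lemma restrict_unital (M : rng_module_cat R) :
  unital_rng_module (iota e : R) M ->
  unital_pointed_module e (restrict_functor M).
Proof. by []. Qed.

End Unital.

End ModuleIsomorphism.

(** * Pointed modules as an abelian category, directly from the action of [T] *)

Section PointedModulesAbelian.
Variable T : truss.
Local Notation K := (pointed_module_cat T).
Implicit Types G H : pointed_module T.

Lemma pmod_act0 G (t : T) : act t (0 : G) = 0.
Proof. by rewrite -[in LHS](subrr (0 : G)) pmod_actB subrr. Qed.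

Lemma pmod_actN G (t : T) (g : G) : act t (- g) = - act t g.
Proof. by rewrite -[in LHS](sub0r g) pmod_actB pmod_act0 sub0r. Qed.

Section HomGroup.
Variables G H : pointed_module T.

Definition op_add (f g : op_hom G H) : op_hom G H.
Proof.
refine (@OpHom T G H (f \+ g : {additive G -> H}) _).
by move=> t x; rewrite /= !op_fun_act pmod_actD.
Defined.

Definition op_zero : op_hom G H.
Proof.
refine (@OpHom T G H (\0 : {additive G -> H}) _).
by move=> t x; rewrite /= pmod_act0.
Defined.

Definition op_opp (f : op_hom G H) : op_hom G H.
Proof.
refine (@OpHom T G H ((\- f)%R : {additive G -> H}) _).
by move=> t x; rewrite /= op_fun_act pmod_actN.
Defined.

End HomGroup.

Definition pmod_preadditive : preadditive K.
Proof.
refine (@Preadditive K op_add op_zero op_opp _ _ _ _ _ _).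
- by move=> G H f g h; apply: op_hom_ext => x; apply: addrA.
- by move=> G H f g; apply: op_hom_ext => x; apply: addrC.
- by move=> G H f; apply: op_hom_ext => x; apply: add0r.
- by move=> G H f; apply: op_hom_ext => x; apply: addNr.
- by move=> G H L g h f; apply: op_hom_ext.
- by move=> G H L h f g; apply: op_hom_ext => x; apply: raddfD.
Defined.

(** The integers modulo 1, ['I_1], serve as the trivial group. *)
Definition zero_pmod : pointed_module T.
Proof.
refine (@PointedModule T (@OpGroup T 'I_1 (fun t g => g)) _ _ _) => //.
by move=> t t' t'' g; rewrite /= !(ord1 g) subrr addr0.
Defined.

Lemma zero_pmodP : is_zero_object (zero_pmod : K).
Proof.
move=> G; split.
  exists (op_zero G zero_pmod); split=> // f _.
  by apply: op_hom_ext => x; rewrite !ord1.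
exists (op_zero zero_pmod G); split=> // f _.
by apply: op_hom_ext => x; rewrite !ord1 !raddf0.
Qed.

Section Biproduct.
Variables G H : pointed_module T.

Definition prod_pmod : pointed_module T.
Proof.
refine (@PointedModule T (@OpGroup T (G * H)%type
  (fun t x => (act t x.1, act t x.2))) _ _ _).
- by move=> t t' g; rewrite /= !pmod_actM.
- by move=> t t' t'' g; rewrite /= !pmod_act_brk.
- by move=> t g h; rewrite /= !pmod_actD.
Defined.

Definition op_inl : op_hom G prod_pmod.
Proof.
refine (@op_hom_of T G prod_pmod (fun x => (x, 0)) _ _).
- by move=> x y; congr pair; rewrite subr0.
- by move=> t x; rewrite /= pmod_act0.
Defined.

Definition op_inr : op_hom H prod_pmod.
Proof.
refine (@op_hom_of T H prod_pmod (fun x => (0, x)) _ _).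
- by move=> x y; congr pair; rewrite subr0.
- by move=> t x; rewrite /= pmod_act0.
Defined.

Definition op_fst : op_hom prod_pmod G :=
  @op_hom_of T prod_pmod G fst (fun x y => erefl) (fun t x => erefl).

Definition op_snd : op_hom prod_pmod H :=
  @op_hom_of T prod_pmod H snd (fun x y => erefl) (fun t x => erefl).

Lemma prod_pmodP :
  @is_biproduct K pmod_preadditive G H prod_pmod op_inl op_inr op_fst op_snd.
Proof.
split; apply: op_hom_ext => // -[x y].
by congr pair; rewrite /= ?addr0 ?add0r.
Qed.

End Biproduct.

(** * Submodules and quotient modules *)

Section SubQuotient.
Variables (G : pointed_module T) (S : zmodClosed G).
Hypothesis S_act : forall t x, x \in S -> act t x \in S.

Definition sub_pmod : pointed_module T.
Proof.
refine (@PointedModule T (@OpGroup T (subgroup S)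
  (fun t x => Subgroup (S_act t (valP x)))) _ _ _).
- by move=> t t' x; apply: val_inj; apply: pmod_actM.
- by move=> t t' t'' x; apply: val_inj; apply: pmod_act_brk.
- by move=> t x y; apply: val_inj; apply: pmod_actD.
Defined.

Definition sub_pmod_incl : op_hom sub_pmod G :=
  @op_hom_of T sub_pmod G val (fun x y => erefl) (fun t x => erefl).

Local Notation piS := \pi_(Quotient.quot S).

Definition quot_act (t : T) (q : Quotient.quot S) : Quotient.quot S :=
  piS (act t (repr q)).

(** The chosen representative differs from [x] by an element of [S], and [S] is stable under the
    action. *)
Fact quot_act_pi t (x : G) : quot_act t (piS x) = piS (act t x).
Proof.
apply/eqP; rewrite -Quotient.idealrBE -pmod_actB; apply: S_act.
by rewrite Quotient.idealrBE reprK.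
Qed.

Definition quot_pmod : pointed_module T.
Proof.
refine (@PointedModule T (@OpGroup T (Quotient.quot S) quot_act) _ _ _).
- move=> t t'; elim/quotW=> x.
  by rewrite /= (quot_act_pi t') !quot_act_pi pmod_actM.
- move=> t t' t''; elim/quotW=> x; rewrite /= !quot_act_pi pmod_act_brk.
  by rewrite raddfD raddfB.
- move=> t; elim/quotW=> x; elim/quotW=> y; rewrite /= -raddfD !quot_act_pi.
  by rewrite pmod_actD raddfD.
Defined.

Definition quot_pmod_proj : op_hom G quot_pmod.
Proof.
refine (@op_hom_of T G quot_pmod piS _ _).
- by move=> x y; apply: raddfB.
- by move=> t x; rewrite /= quot_act_pi.
Defined.

Lemma quot_pmod_proj_eq0 x : quot_pmod_proj x = 0 <-> x \in S.
Proof.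
(* Writing [x] as [x - 0] turns membership in [S] into equality of the classes of [x] and 0. *)
rewrite -[in X in _ <-> X](subr0 x) Quotient.idealrBE.
have -> : piS 0 = 0 by exact: raddf0.
by split=> /eqP.
Qed.

Lemma quot_pmod_proj_surj (q : quot_pmod) : exists x, quot_pmod_proj x = q.
Proof. by exists (repr (q : Quotient.quot S)); apply: reprK. Qed.

End SubQuotient.

(** * Kernels, cokernels, monomorphisms and epimorphisms *)

(** Allowing any injective [i] with the right image covers both the concrete kernel and a
    monomorphism viewed as the kernel of its cokernel. *)
Lemma kernel_criterion (G H L : pointed_module T) (f : op_hom G H)
    (i : op_hom L G) :
    injective i -> (forall x, f x = 0 <-> exists y, i y = x) ->
  @is_kernel K pmod_preadditive G H L f i.
Proof.
move=> i_inj fi; split.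
  by apply: op_hom_ext => y; apply/fi; exists y.
move=> M g fg0.
have g_im x : exists y, i y = g x.
  by apply/fi; have := congr1 (fun h : op_hom M H => h x) fg0.
(* Preimages under [i] are chosen pointwise; injectivity of [i] makes the choice additive and
   equivariant. *)
pose u x := sval (cid (g_im x)).
have uE x : i (u x) = g x := svalP (cid (g_im x)).
have uB : {morph u : x y / x - y}.
  by move=> x y; apply: i_inj; rewrite raddfB !uE raddfB.
have u_act t x : u (act t x) = act t (u x).
  by apply: i_inj; rewrite op_fun_act !uE op_fun_act.
exists (op_hom_of uB u_act); split; first exact: op_hom_ext.
move=> v iv; apply: op_hom_ext => x; apply: i_inj.
by rewrite /= uE -iv.
Qed.

Lemma cokernel_criterion (G H L : pointed_module T) (f : op_hom G H)
    (p : op_hom H L) :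
    (forall z, exists y, p y = z) ->
    (forall y, p y = 0 <-> exists x, f x = y) ->
  @is_cokernel K pmod_preadditive G H L f p.
Proof.
move=> p_surj pf; split.
  by apply: op_hom_ext => x; apply/pf; exists x.
move=> M g gf0.
(* Two elements of a fibre of [p] differ by some [f x], which [g] kills. *)
have g_eq y y' : p y = p y' -> g y = g y'.
  move=> pyy'; have [|x fx] := (pf (y - y')).1.
    by rewrite raddfB pyy' subrr.
  apply/eqP; rewrite -subr_eq0 -raddfB -fx.
  by have := congr1 (fun h : op_hom G M => h x) gf0 => /= ->.
(* A set-theoretic section of [p]: by [g_eq], following it with [g] gives a map independent of the
   choices, hence a homomorphism. *)
pose s z := sval (cid (p_surj z)).
have sK z : p (s z) = z := svalP (cid (p_surj z)).
pose u z := g (s z); have uE y : u (p y) = g y by apply: g_eq; rewrite sK.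
have uB : {morph u : x y / x - y}.
  by move=> x y; rewrite -(sK x) -(sK y) -raddfB !uE raddfB.
have u_act t x : u (act t x) = act t (u x).
  by rewrite -(sK x) -op_fun_act !uE op_fun_act.
exists (op_hom_of uB u_act); split; first exact: op_hom_ext.
by move=> v vp; apply: op_hom_ext => z; rewrite -(sK z) /= uE -vp.
Qed.

Section KernelCokernel.
Variables (G H : pointed_module T) (f : op_hom G H).

Fact ker0 : f 0 = 0. Proof. exact: raddf0. Qed.
Fact kerB x y : f x = 0 -> f y = 0 -> f (x - y) = 0.
Proof. by rewrite raddfB => -> ->; rewrite subrr. Qed.
Definition ker_closed : zmodClosed G := prop_zmodClosed ker0 kerB.
Fact ker_act t x : x \in ker_closed -> act t x \in ker_closed.
Proof.
rewrite !in_prop_zmodClosed => /asboolP fx; apply/asboolP.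
by rewrite op_fun_act fx pmod_act0.
Qed.

Fact im0 : exists x, f x = 0. Proof. by exists 0; apply: raddf0. Qed.
Fact imB y y' :
  (exists x, f x = y) -> (exists x, f x = y') -> exists x, f x = y - y'.
Proof. by move=> [x <-] [x' <-]; exists (x - x'); apply: raddfB. Qed.
Definition im_closed : zmodClosed H := prop_zmodClosed im0 imB.
Fact im_act t y : y \in im_closed -> act t y \in im_closed.
Proof.
rewrite !in_prop_zmodClosed => /asboolP [x <-]; apply/asboolP.
by exists (act t x); rewrite op_fun_act.
Qed.

Definition ker_pmod := sub_pmod ker_act.
Definition ker_incl : op_hom ker_pmod G := sub_pmod_incl ker_act.
Definition coker_pmod := quot_pmod im_act.
Definition coker_proj : op_hom H coker_pmod := quot_pmod_proj im_act.

Lemma ker_inclP x : f x = 0 <-> exists y, ker_incl y = x.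
Proof.
split=> [fx|[y <-]]; last first.
  by have := valP y; rewrite in_prop_zmodClosed => /asboolP.
have xS : x \in ker_closed by rewrite in_prop_zmodClosed; apply/asboolP.
by exists (Subgroup xS).
Qed.

Lemma coker_projP y : coker_proj y = 0 <-> exists x, f x = y.
Proof.
rewrite quot_pmod_proj_eq0 in_prop_zmodClosed.
by split=> [/asboolP|?]; last apply/asboolP.
Qed.

Lemma ker_incl_kernel :
  @is_kernel K pmod_preadditive G H ker_pmod f ker_incl.
Proof. by apply: kernel_criterion => [x y /val_inj|x] //; apply: ker_inclP. Qed.

Lemma coker_proj_cokernel :
  @is_cokernel K pmod_preadditive G H coker_pmod f coker_proj.
Proof.
by apply: cokernel_criterion; [apply: quot_pmod_proj_surj|apply: coker_projP].
Qed.

(** A monomorphism cannot distinguish the inclusion of its kernel from the zero map, so its kernel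
    is trivial. *)
Lemma mono_injective : @mono K G H f -> injective f.
Proof.
move=> f_mono.
have incl0 : ker_incl = op_zero ker_pmod G.
  apply: (f_mono (ker_pmod : K)); apply: op_hom_ext => y.
  by rewrite /= raddf0; apply/ker_inclP; exists y.
move=> x x' fxx'; have [|y yE] := (ker_inclP (x - x')).1.
  by rewrite raddfB fxx' subrr.
by apply/eqP; rewrite -subr_eq0 -yE incl0.
Qed.

(** Composed with [f], the projection to the cokernel and the zero map agree; hence the projection
    vanishes and every [y] lies in the image. *)
Lemma epi_surjective : @epi K G H f -> forall y, exists x, f x = y.
Proof.
move=> f_epi y; apply/coker_projP.
have -> // : coker_proj = op_zero H coker_pmod.
apply: (f_epi (coker_pmod : K)); apply: op_hom_ext => x /=.
by apply/coker_projP; exists x.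
Qed.

End KernelCokernel.

Lemma pointed_module_abelian : is_abelian K.
Proof.
exists pmod_preadditive; split; first by exists zero_pmod; apply: zero_pmodP.
split.
  move=> G H; exists (prod_pmod G H), (op_inl G H), (op_inr G H).
  by exists (op_fst G H), (op_snd G H); apply: prod_pmodP.
split.
  move=> G H f; exists (ker_pmod f), (ker_incl f).
  exact: ker_incl_kernel.
split.
  move=> G H f; exists (coker_pmod f), (coker_proj f).
  exact: coker_proj_cokernel.
split=> G H f.
  (* A monomorphism is the kernel of its cokernel projection, whose zero set is the image of [f]. *)
  move=> /mono_injective f_inj; exists (coker_pmod f), (coker_proj f).
  by apply: kernel_criterion => // y; apply: coker_projP.
(* Dually, an epimorphism is the cokernel of its kernel inclusion. *)
move=> /epi_surjective f_surj; exists (ker_pmod f), (ker_incl f).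
by apply: cokernel_criterion => // x; apply: ker_inclP.
Qed.

End PointedModulesAbelian.

Theorem theorem3p1 (T : truss) (R : rng) (iota : truss_hom T (truss_of_rng R))
    (univ : is_universal_ring iota) :
  (exists F : functor (pointed_module_cat T) (rng_module_cat R),
     is_isomorphism F /\
     (forall e : T, is_unit (@tmul T) e ->
        exists u : R, is_unit (@rmul R) u /\
        exists FU : forall G : pointed_module_cat T,
            unital_pointed_module e G -> unital_rng_module u (F G),
          is_isomorphism (functor_restr FU))) /\
  is_abelian (pointed_module_cat T).
Proof.
split; last exact: pointed_module_abelian.
exists (extend_functor univ); split.
  exists (restrict_functor iota); split; first exact: restrict_extend.
  exact: extend_restrict.
(* The unit [iota e] acts on an extended module as [e] does, so unitality passes in both directions
   and both functors restrict. *)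
move=> e e_unit; exists (iota e); split; first exact: universal_unit.
exists (@extend_unital T R iota univ e).
apply: (restr_isomorphism _ _ _ (@restrict_unital T R iota e)).
  exact: restrict_extend.
exact: extend_restrict.
Qed.
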